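(* Let $p\in\mathcal P$ and let $n\geqslant 0$ be an integer. Let $24_p^{-1}$ denote the integer satisfying $24\cdot 24_p^{-1}\equiv 1\pmod p$ chosen so that $1\leqslant -24_p^{-1}\leqslant p-1$. Then for every integer $\alpha$ with $0\leqslant \alpha<p$ and $\alpha\neq\lfloor p/24\rfloor$, $$b_3\big(2(p^2n+p\alpha-24_p^{-1})\big)\equiv 0\pmod 2.$$
   Context: For a positive integer $n$, $b_3(n)$ denotes the number of $3$-regular partitions of $n$, i.e. partitions of $n$ none of whose parts is divisible by $3$ (with $b_3(0)=1$); equivalently $\sum_{n\ge0}b_3(n)q^n=\prod_{k\ge1}\frac{1-q^{3k}}{1-q^k}$. A solution $(x,y)\in\mathbb Z^2$ of a Diophantine equation is called primitive if $\gcd(x,y)=1$. $\mathcal P$ denotes the set of primes $p$ such that for some $j\in\{1,4,8\}$ the equation $x^2+216y^2=jp$ has a primitive solution. *)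

(* Defs.v *)
From HB Require Import structures.
From mathcomp Require Import all_boot all_order all_algebra.

Set Implicit Arguments.
Unset Strict Implicit.
Unset Printing Implicit Defensive.

(* A partition of n is encoded by its multiplicity function: f i is the number
   of parts equal to i.+1.  Every part of a partition of n is at most n, and no
   part occurs more than n times, so no partition is lost by these bounds. *)
Definition partition_of (n : nat) (f : {ffun 'I_n -> 'I_n.+1}) : bool :=
  \sum_(i < n) f i * i.+1 == n.

Definition regular_partition (l n : nat) (f : {ffun 'I_n -> 'I_n.+1}) : bool :=
  partition_of f && [forall i : 'I_n, (0 < f i) ==> ~~ (l %| i.+1)].

Definition b3 (n : nat) : nat :=
  #|[set f : {ffun 'I_n -> 'I_n.+1} | regular_partition 3 f]|.

Local Open Scope ring_scope.

Definition has_primitive_solution (N : int) : Prop :=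
  exists x y : int, coprimez x y /\ x ^+ 2 + 216 * y ^+ 2 = N.

Definition calP (p : nat) : Prop :=
  prime p /\
  exists2 j : nat, j \in [:: 1; 4; 8]%N & has_primitive_solution (j * p)%N%:Z.

(* Main.v *)
Require Import Defs.
From mathcomp Require Import all_boot all_order all_algebra.
From mathcomp Require Import zify ring.

Set Implicit Arguments.
Unset Strict Implicit.
Unset Printing Implicit Defensive.

Import Order.TTheory GRing.Theory Num.Theory.

Local Open Scope ring_scope.

(* Work with power series over F_2, and let E(q) be the sum of q^((u^2-1)/24)
   over u = 1 mod 6, which is the Euler product (pentagonal number theorem), and
   S(q) = 1 + the sum of q^(v^2) over v = 1 mod 3.  Parity arguments on the
   solutions of x^2 + 2 y^2 = 24 n + 3 give E(q) E(q^2) = E(q^3) S(q), from which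
   the generating function of b3(2m) is E(q) S(q).  Hence b3(2m) has the parity
   of the number of solutions of u^2 + 24 v^2 = 24 m + 1 with u = 1 mod 6 and
   v = 0 or v = 1 mod 3.  For p in P there is an element of norm p^2 in
   Z[sqrt(-216)] not divisible by p, and when p divides 24 m + 1 exactly once,
   division by p after multiplication by this element or its conjugate (only
   one of them works) pairs off the solutions.  The excluded alpha is the one for
   which p^2 divides 24 m + 1. *)

(** * Parity by involutions *)

(** Points that are not fixed leave the list in pairs [x], [f x], so only fixed points affect the
    parity. *)
Lemma odd_size_involution (T : eqType) (f : T -> T) (s : seq T) :
  uniq s -> {in s, forall x, f x \in s} -> {in s, forall x, f (f x) = x} ->
  odd (size s) = odd (count (fun x => f x == x) s).
Proof.
have [n] := ubnP (size s).
elim: n s => // n IHn [|x s] //= sz_s /andP[xNs us] fs fK.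
have fx : f x \in x :: s by apply: fs; rewrite mem_head.
have ffx : f (f x) = x by apply: fK; rewrite mem_head.
have [fxx|fxNx] := eqVneq (f x) x.
  rewrite /= (IHn s) //.
  - move=> y ys; have := fs y; rewrite !inE ys orbT => /(_ isT) /orP[/eqP fyx|//].
    by have := fK y; rewrite !inE ys orbT fyx fxx => /(_ isT) exy; rewrite exy ys in xNs.
  - by move=> y ys; apply: fK; rewrite inE ys orbT.
move: fx; rewrite inE (negPf fxNx) /= => fxs.
have pe := perm_to_rem fxs.
have urem := rem_uniq (f x) us.
have xNrem y : y \in rem (f x) s -> (y \in s) /\ y != f x.
  by rewrite mem_rem_uniq // !inE => /andP[].
rewrite (perm_size pe) (permP pe) /= ffx (eq_sym x) (negPf fxNx) /= negbK.
apply: IHn => //.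
- by have := perm_size pe; rewrite /= => h; lia.
- move=> y /xNrem[ys yNfx].
  have := fs y; rewrite !inE ys orbT => /(_ isT) /orP[/eqP fyx|fys].
    by have := fK y; rewrite inE ys orbT fyx => /(_ isT) e; rewrite e eqxx in yNfx.
  rewrite mem_rem_uniq // !inE fys andbT; apply/eqP => fyfx.
  have := fK y; rewrite inE ys orbT fyfx ffx => /(_ isT) exy.
  by rewrite exy ys in xNs.
- by move=> y /xNrem[ys _]; apply: fK; rewrite inE ys orbT.
Qed.

(** * Power series truncated at a given precision, and their even parts *)

Section Trunc.
Variable R : comNzRingType.
Implicit Types p q r f g h : {poly R}.

Definition eqX (L : nat) p q := forall i, (i < L)%N -> p`_i = q`_i.

Lemma eqX_sym L p q : eqX L p q -> eqX L q p.
Proof. by move=> h i iL; rewrite h. Qed.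

Lemma eqX_trans L q p r : eqX L p q -> eqX L q r -> eqX L p r.
Proof. by move=> h1 h2 i iL; rewrite h1 // h2. Qed.

Lemma eqX_le L L' p q : (L' <= L)%N -> eqX L p q -> eqX L' p q.
Proof. by move=> le h i iL; apply: h; apply: leq_trans le. Qed.

Lemma eqXM L p q f g : eqX L p q -> eqX L f g -> eqX L (p * f) (q * g).
Proof.
move=> h1 h2 i iL; rewrite !coefM; apply: eq_bigr => j _.
by rewrite h1 ?h2 //; have := ltn_ord j; lia.
Qed.

Lemma eqXD L p q f g : eqX L p q -> eqX L f g -> eqX L (p + f) (q + g).
Proof. by move=> h1 h2 i iL; rewrite !coefD h1 ?h2. Qed.

Lemma eqX_prod L (I : Type) (s : seq I) (P : pred I) (F G : I -> {poly R}) :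
  (forall i, P i -> eqX L (F i) (G i)) ->
  eqX L (\prod_(i <- s | P i) F i) (\prod_(i <- s | P i) G i).
Proof.
move=> h; apply: (big_ind2 (eqX L)) => // p q f g; exact: eqXM.
Qed.

(** A series with constant term 1 is invertible: in degree [i] of the product, the top coefficient
    of [g] occurs with factor 1 and the other terms involve only lower ones. *)
Lemma eqX_cancel L f g h : f`_0 = 1 -> eqX L (f * g) (f * h) -> eqX L g h.
Proof.
move=> f0 e; elim/ltn_ind => i IHi iL.
have := e i iL; rewrite !coefM !big_ord_recl /= f0 !mul1r subn0.
rewrite [X in _ + X = _](_ : _ = \sum_(j < i) f`_(bump 0 j) * h`_(i - bump 0 j)).
  by move/addIr.
apply: eq_bigr => j _; rewrite IHi //; have := ltn_ord j; rewrite /bump /=; lia.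
Qed.

Lemma eqX_addX L k p : (L <= k)%N -> eqX L (p + 'X^k) p.
Proof. by move=> le i iL; rewrite coefD coefXn ltn_eqF ?addr0 //; apply: leq_trans le. Qed.

Lemma coef_compXn k p i : (0 < k)%N ->
  (p \Po 'X^k)`_i = if (k %| i)%N then p`_(i %/ k) else 0.
Proof. by move=> k0; rewrite coef_comp_poly_Xn. Qed.

Lemma eqX_comp L k p q : (0 < k)%N -> eqX L p q ->
  eqX (k * L) (p \Po 'X^k) (q \Po 'X^k).
Proof.
move=> k0 e i iL; rewrite !coef_compXn //; case: ifP => // /dvdnP[j ij].
by apply: e; rewrite ltn_divLR // mulnC.
Qed.

Lemma even_poly_comp_add p q :
  even_poly ((p \Po 'X^2) + (q \Po 'X^2) * 'X) = p.
Proof.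
apply/polyP => i; rewrite coef_even_poly coefD coefMX !coef_compXn //.
rewrite dvdn2 odd_double /= divn2 doubleK; case: i => [|i] /=; first by rewrite addr0.
by rewrite dvdn2 /= odd_double /= addr0.
Qed.

(** Multiplying by a series in X^2 respects the splitting of [q] into even and odd parts. *)
Lemma even_poly_comp p q :
  even_poly ((p \Po 'X^2) * q) = p * even_poly q.
Proof.
rewrite -{1}(poly_even_odd q) mulrDr mulrA -!rmorphM /=.
exact: even_poly_comp_add.
Qed.

Lemma eqX_even L p q : eqX L.*2 p q -> eqX L (even_poly p) (even_poly q).
Proof. by move=> e i iL; rewrite !coef_even_poly e // ltn_double. Qed.

End Trunc.

(** * The pentagonal number theorem modulo 2 *)

Section CharTwo.
Implicit Types p q : {poly 'F_2}.

Lemma addpp p : p + p = 0.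
Proof.
apply/polyP => i; rewrite coefD coef0.
by apply/eqP; move: p`_i; do 2?case=> //; case.
Qed.

Lemma opp_poly_F2 p : - p = p.
Proof. by apply/eqP; rewrite eq_sym -addr_eq0 addpp. Qed.

(** The Frobenius map: cross terms vanish and constants in F_2 are their own squares. *)
Lemma sqr_poly_F2 p : p ^+ 2 = p \Po 'X^2.
Proof.
elim/poly_ind: p => [|p c IHp]; first by rewrite comp_poly0 expr0n.
rewrite comp_polyD comp_polyM comp_polyX comp_polyC -IHp sqrrD exprMn.
rewrite mulr2n addpp addr0 -rmorphXn /=; congr (_ + _%:P).
by case: c => [[|[|c]] Hc]; apply/eqP.
Qed.

(* Shanks's telescoping: the sum below is congruent to its first term [s = 0],
   the Euler product, and in characteristic 2 the sums for [n] and [n.-1]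
   differ by the next two pentagonal powers. *)
Definition shanks n : {poly 'F_2} :=
  \sum_(0 <= s < n.+1)
     (\prod_(s.+1 <= k < n.+1) (1 + 'X^k)) * 'X^(s * n + 'C(s.+1, 2)).

Lemma shanksS n :
  shanks n.+1 = shanks n + 'X^(n.+1 * n.+1 + 'C(n.+1, 2)) + 'X^(n.+1 * n.+1 + 'C(n.+2, 2)).
Proof.
rewrite /shanks [LHS]big_nat_recr //= [X in _ + X * _]big_geq // mul1r; congr (_ + _).
(* [b] is chosen so that the summands for [n.+1] and [n] differ by [b s.+1 - b s]. The boundary
   value [b n.+1] is the first new power; the second is the summand [s = n.+1] split off above. *)
pose b s : {poly 'F_2} :=
  (if s == 0 then 0 else (\prod_(s <= k < n.+1) (1 + 'X^k)) * 'X^(s * n.+1 + 'C(s, 2))).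
rewrite [LHS](_ : _ = \sum_(0 <= s < n.+1)
     ((\prod_(s.+1 <= k < n.+1) (1 + 'X^k)) * 'X^(s * n + 'C(s.+1, 2)) + (b s.+1 - b s))).
  rewrite big_split /= telescope_sumr // subr0; congr (_ + _).
  by rewrite /b /= big_geq // mul1r.
rewrite !big_nat; apply: eq_bigr => s /andP[_ sn].
rewrite [X in X * _ = _]big_nat_recr //=.
rewrite opp_poly_F2 /b /=; case: s sn => [|s] sn /=.
  by rewrite bin_small // !mul0n mul1n !addn0; ring.
rewrite [X in _ + (_ + X * _)]big_ltn; last by lia.
set Q := \prod_(s.+2 <= i < _) _; set Y : {poly 'F_2} := 'X^(s.+1 * n.+1 + 'C(s.+1, 2)).
have -> : (s.+1 * n.+1 + 'C(s.+2, 2) = s.+1 + (s.+1 * n.+1 + 'C(s.+1, 2)))%N.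
  by rewrite (binS s.+1) bin1; lia.
have -> : (s.+1 * n + 'C(s.+2, 2) = s.+1 * n.+1 + 'C(s.+1, 2))%N.
  by rewrite (binS s.+1) bin1; lia.
have -> : (s.+2 * n.+1 + 'C(s.+2, 2) = n.+1 + (s.+1 + (s.+1 * n.+1 + 'C(s.+1, 2))))%N.
  by rewrite (binS s.+1) bin1; lia.
(* The two sides differ by twice [Q * Y], which is added explicitly because [ring] does not use the
   characteristic. *)
rewrite (exprD _ n.+1) !(exprD _ s.+1) -/Y -[LHS]addr0 -(addpp (Q * Y)); ring.
Qed.

(** For s >= 1 the exponent s n + C(s + 1, 2) exceeds n, so only s = 0 is visible. *)
Lemma shanks_euler n : eqX n.+1 (shanks n) (\prod_(1 <= k < n.+1) (1 + 'X^k)).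
Proof.
rewrite /shanks [X in eqX _ X]big_ltn // bin_small // mulr1 => i iL.
rewrite coefD [X in _ + X](_ : _ = 0) ?addr0 // coef_sum big_nat big1 // => s /andP[s0 sn].
rewrite coefMXn ifT //; rewrite (leq_trans iL) //.
have : (0 < 'C(s.+1, 2))%N by rewrite bin_gt0; lia.
by move: s0; case: s {sn} => // s _; lia.
Qed.

End CharTwo.

(** * Pentagonal exponents *)

(** Kept as two lists so that passing from [K] to [K.+1] appends one entry to each, as the induction
    in [shanks_pent] requires. *)
Definition zrange (K : nat) : seq int :=
  [seq k%:Z | k <- iota 0 K.+1] ++ [seq Negz k | k <- iota 0 K].

Lemma mem_zrange K x : (x \in zrange K) = (`|x| <= K)%N.
Proof.
rewrite mem_cat; apply/orP/idP => [[/mapP[k]|/mapP[k]]|].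
- by rewrite mem_iota => h ->; lia.
- by rewrite mem_iota => h ->; lia.
- case: x => k h; [left|right]; apply/mapP; exists k => //; rewrite mem_iota; lia.
Qed.

Lemma zrange_uniq K : uniq (zrange K).
Proof.
rewrite cat_uniq !map_inj_uniq ?iota_uniq //; last by move=> x y [].
  rewrite andbT /=; apply/hasPn => x /mapP[k _ ->]; apply/negP => /mapP[j _]; lia.
by move=> x y [].
Qed.

Definition urange K := [seq 6 * k + 1 | k <- zrange K].
Definition vrange K := [seq 3 * k + 1 | k <- zrange K].

(** For u = 6 k + 1 this is the generalised pentagonal number k (3 k + 1) / 2. *)
Definition pent (u : int) : nat := `|u ^+ 2 - 1|%N %/ 24.

Lemma pentP u : (u %% 6)%Z = 1 -> u ^+ 2 = 24 * (pent u)%:Z + 1.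
Proof.
move=> h; have -> : u = 6 * (u %/ 6)%Z + 1 by lia.
set k := (u %/ 6)%Z; rewrite /pent.
have [j ej] : exists j : int, k * (3 * k + 1) = 2 * j.
  have [e|e] : (k = 2 * (k %/ 2)%Z) \/ (k = 2 * (k %/ 2)%Z + 1) by lia.
    by exists ((k %/ 2)%Z * (3 * k + 1)); rewrite {1}e; ring.
  by exists (k * (3 * (k %/ 2)%Z + 2)); rewrite {2}e; ring.
have e24 : 24 * j = 12 * (k * (3 * k + 1)) by rewrite ej; ring.
have -> : (6 * k + 1) ^+ 2 - 1 = 24 * j.
  by rewrite e24; ring.
have j0 : 0 <= j by nia.
rewrite abszM mulKn //.
by rewrite gez0_abs // e24; ring.
Qed.

Definition Epoly K : {poly 'F_2} := \sum_(u <- urange K) 'X^(pent u).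

(** Matches the two powers added by [shanksS] with the pentagonal indices n + 1 and -(n + 1). *)
Lemma pent_bin n : (pent (6 * n.+1%:Z + 1) = n.+1 * n.+1 + 'C(n.+2, 2))%N /\
  (pent (6 * Negz n + 1) = n.+1 * n.+1 + 'C(n.+1, 2))%N.
Proof.
have b1 : (n.+1 * n = 2 * 'C(n.+1, 2))%N by rewrite -mul_bin_diag bin1.
have b2 : ('C(n.+2, 2) = 'C(n.+1, 2) + n.+1)%N by rewrite binS bin1.
rewrite b2; split.
  have /pentP : ((6 * n.+1%:Z + 1) %% 6 = 1)%Z by lia.
  nia.
have /pentP : ((6 * Negz n + 1) %% 6 = 1)%Z by lia.
nia.
Qed.

Lemma shanks_pent K : shanks K = Epoly K.
Proof.
rewrite /Epoly /urange /zrange map_cat big_cat !big_map.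
elim: K => [|K IHK].
  by rewrite /shanks big_nat1 big_geq // mul1r /= big_seq1 big_nil addr0.
rewrite shanksS IHK; have [<- <-] := pent_bin K.
rewrite -(addn1 K.+1) -(addn1 K) !iotaD !big_cat /= !big_seq1 !add0n addn1.
ring.
Qed.

(** * Generating function of 3-regular partitions *)

Definition euler_prod K : {poly 'F_2} := \prod_(1 <= k < K.+1) (1 + 'X^k).

(** Here [j] is the multiplicity of the part [k]; the bounds are those of the encoding in [b3], so
    the coefficient of degree [K] can be compared with it directly. *)
Definition reg3_prod K : {poly 'F_2} :=
  \prod_(1 <= k < K.+1 | ~~ (3 %| k)%N) \sum_(j < K.+1) 'X^(k * j).

Lemma eqX_prod1 L (I : Type) (s : seq I) (P : pred I) (F : I -> {poly 'F_2}) :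
  (forall i, P i -> eqX L (F i) 1) -> eqX L (\prod_(i <- s | P i) F i) 1.
Proof. by move=> /(eqX_prod s); rewrite big1_eq. Qed.

(** Parts above [n] and multiplicities above [n] produce only exponents above [n]. *)
Lemma reg3_prod_trunc n K : (n <= K)%N -> eqX n.+1 (reg3_prod K) (reg3_prod n).
Proof.
move=> nK; rewrite /reg3_prod (big_cat_nat (n := n.+1) (p := K.+1)) //= -[X in eqX _ _ X]mulr1.
have tailE k : (0 < k)%N -> eqX n.+1 (\sum_(j < K.+1) 'X^(k * j)) (\sum_(j < n.+1) 'X^(k * j) : {poly 'F_2}).
  move=> k0 i iL; rewrite !coef_sum [RHS](big_ord_widen K.+1 (fun j => ('X^(k * j) : {poly 'F_2})`_i)) //.
  rewrite [RHS]big_mkcond /=; apply: eq_bigr => j _; case: ltnP => // jn.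
  rewrite coefXn ltn_eqF //; nia.
apply: eqXM.
  rewrite big_nat_cond [X in eqX _ _ X]big_nat_cond; apply: eqX_prod => k /andP[/andP[k0 _] _]; exact: tailE.
rewrite big_nat_cond; apply: eqX_prod1 => k /andP[/andP[nk _] _].
apply: (eqX_trans (tailE _ _)); first by lia.
rewrite big_ord_recl muln0 expr0 => i iL.
rewrite coefD coef_sum [X in _ + X]big1 ?addr0 // => j _.
by rewrite coefXn lift0 ltn_eqF // (leq_trans iL) // (leq_trans nk) // leq_pmulr.
Qed.

Lemma coef_reg3_prod n : (reg3_prod n)`_n = (b3 n)%:R.
Proof.
rewrite /reg3_prod big_add1 /= big_mkord.
(* [F] vanishes on forbidden choices, so the product may run over all [i] and expands into a sum
   over all multiplicity functions. *)
pose F (i : 'I_n) (j : 'I_n.+1) : {poly 'F_2} :=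
  if (0 < j)%N ==> ~~ (3 %| i.+1)%N then 'X^(j * i.+1) else 0.
rewrite (_ : \prod_(i < n | _) _ = \prod_(i < n) \sum_(j < n.+1) F i j); last first.
  rewrite big_mkcond /=; apply: eq_bigr => i _; rewrite /F; case: ifPn => [i3|_].
    by apply: eq_bigr => j _; rewrite implybT mulnC.
  rewrite big_ord_recl /= mul0n expr0 big1 ?addr0 //.
rewrite bigA_distr_bigA coef_sum /b3 -sum1_card natr_sum big_mkcond [RHS]big_mkcond /=.
apply: eq_bigr => f _; rewrite inE /regular_partition /partition_of.
case: forallP => [reg|nreg].
  rewrite (eq_bigr (fun i => 'X^(f i * i.+1))) => [|i _]; last by rewrite /F reg.
  by rewrite -(big_morph _ (exprD 'X) (expr0 _)) coefXn andbT eq_sym; case: eqP.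
rewrite andbF; have [i /negPf iP] : exists i, ~~ ((0 < f i)%N ==> ~~ (3 %| i.+1)%N).
  by apply/existsP; rewrite -negb_forall; apply/negP => /forallP.
by rewrite (bigD1 i) //= {1}/F iP mul0r coef0.
Qed.

Lemma euler_prod_mult3 K :
  \prod_(1 <= k < (3 * K).+1 | (3 %| k)%N) (1 + 'X^k) = euler_prod K \Po 'X^3.
Proof.
rewrite /euler_prod rmorph_prod /= big_mkcond /=; elim: K => [|K IHK]; first by rewrite !big_geq.
rewrite [RHS]big_nat_recr //= -IHK mulnS !addSn add0n.
rewrite (big_nat_recr (3 * K).+3) // (big_nat_recr (3 * K).+2) // (big_nat_recr (3 * K).+1) //=.
have -> : (3 %| (3 * K).+1)%N = false by lia.
have -> : (3 %| (3 * K).+2)%N = false by lia.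
have -> : (3 %| (3 * K).+3)%N by lia.
by rewrite !mulr1 rmorphD rmorph1 /= comp_Xn_poly -exprM mulnS.
Qed.

(** For [k] prime to 3 the geometric sum cancels the Euler factor up to X^(k (K + 1)). The factors
    with 3 dividing [k] remain, and those with [k > K] are 1 at this precision. *)
Lemma reg3_mul_euler K : eqX K.+1 (reg3_prod K * euler_prod K) (euler_prod K \Po 'X^3).
Proof.
rewrite -euler_prod_mult3 (big_cat_nat (n := K.+1) (p := (3 * K).+1)) //=; last by lia.
rewrite /euler_prod (bigID (fun k => 3 %| k)%N) /= mulrCA; apply: eqXM => //.
apply: (eqX_trans (q := 1)); last first.
  apply: eqX_sym; rewrite big_nat_cond; apply: eqX_prod1 => k /andP[/andP[Kk _] _].
  exact: eqX_addX.
rewrite -big_split /=  big_nat_cond; apply: eqX_prod1 => k /andP[/andP[k0 _] _].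
have -> : (\sum_(j < K.+1) 'X^(k * j)) * (1 + 'X^k) = 1 + 'X^(k * K.+1) :> {poly 'F_2}.
  under eq_bigr do rewrite exprM.
  by rewrite mulrC addrC -(opp_poly_F2 1) -subrX1 addrC exprM.
apply: eqX_addX; nia.
Qed.

(** * The theta identity, from solutions of x^2 + 2 y^2 = 24 n + 3 *)

Lemma natr_F2_odd n : n%:R = (odd n)%:R :> 'F_2.
Proof. by rewrite -(Fp_nat_mod (p := 2)) // modn2. Qed.

Lemma urange_mod K u : u \in urange K -> (u %% 6)%Z = 1.
Proof. by case/mapP => k _ ->; lia. Qed.

Lemma mem_urange K u : (u %% 6)%Z = 1 -> (`|u| <= K)%N -> u \in urange K.
Proof.
move=> u6 uK; apply/mapP; exists (u %/ 6)%Z; last by lia.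
by rewrite mem_zrange; lia.
Qed.

Lemma urange_uniq K : uniq (urange K).
Proof. by rewrite map_inj_uniq ?zrange_uniq // => x y; lia. Qed.

Lemma vrange_mod K v : v \in vrange K -> (v %% 3)%Z = 1.
Proof. by case/mapP => k _ ->; lia. Qed.

Lemma mem_vrange K v : (v %% 3)%Z = 1 -> (`|v| <= K)%N -> v \in vrange K.
Proof.
move=> v3 vK; apply/mapP; exists (v %/ 3)%Z; last by lia.
by rewrite mem_zrange; lia.
Qed.

Lemma vrange_uniq K : uniq (vrange K).
Proof. by rewrite map_inj_uniq ?zrange_uniq // => x y; lia. Qed.

(** The residue 1 modulo 3 selects one of v and -v for each v prime to 3. *)
Definition Wpoly K : {poly 'F_2} := \sum_(v <- vrange K) 'X^(`|v| ^ 2)%N.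

Lemma coef_sumX (T : Type) (s : seq T) (a : T -> nat) n :
  (\sum_(x <- s) 'X^(a x) : {poly 'F_2})`_n = (count (fun x => a x == n) s)%:R.
Proof.
rewrite coef_sum -sum1_count natr_sum [RHS]big_mkcond /=; apply: eq_bigr => x _.
by rewrite coefXn eq_sym; case: eqP.
Qed.

Lemma mul_sumX (T U : Type) (s : seq T) (t : seq U) (a : T -> nat) (b : U -> nat) :
  (\sum_(x <- s) 'X^(a x)) * (\sum_(y <- t) 'X^(b y)) =
  \sum_(z <- allpairs pair s t) 'X^(a z.1 + b z.2) :> {poly 'F_2}.
Proof.
rewrite big_allpairs mulr_suml; apply: eq_bigr => x _.
by rewrite mulr_sumr; apply: eq_bigr => y _; rewrite exprD.
Qed.

Lemma comp_sumX (T : Type) (s : seq T) (a : T -> nat) k :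
  (\sum_(x <- s) 'X^(a x)) \Po 'X^k = \sum_(x <- s) 'X^(k * a x) :> {poly 'F_2}.
Proof. by rewrite rmorph_sum /=; apply: eq_bigr => x _; rewrite comp_Xn_poly exprM. Qed.

(* Multiplication of [x + y sqrt(-2)] by the unit [(-1 + 2 sqrt(-2)) / 3] of
   norm 1, composed with conjugation, and normalised so that both coordinates
   stay congruent to 1 modulo 6; it is not integral when [9 %| 2 * x + y]. *)
Definition flip3 (z : int * int) : int * int :=
  let: (x, y) := z in
  if ((2 * x + y) %% 9 == 0)%Z then z
  else if ((2 * x + y) %% 9 == 3)%Z then (((4 * y - x) %/ 3)%Z, ((2 * x + y) %/ 3)%Z)
  else (((x - 4 * y) %/ 3)%Z, (- (2 * x + y) %/ 3)%Z).

Definition sols (s t : seq int) (a b : int) (N : int) :=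
  [seq z <- allpairs pair s t | a * z.1 ^+ 2 + b * z.2 ^+ 2 == N].

Lemma sols_uniq s t a b N : uniq s -> uniq t -> uniq (sols s t a b N).
Proof. by move=> us ut; rewrite filter_uniq // allpairs_uniq //; case=> ? ? [? ?]. Qed.

Lemma mem_sols s t a b N x y :
  ((x, y) \in sols s t a b N) = [&& x \in s, y \in t & a * x ^+ 2 + b * y ^+ 2 == N].
Proof.
rewrite mem_filter /= andbC andbA; congr (_ && _).
apply/allpairsP/andP => [[[x' y'] /= [xs yt [-> ->]]] //|[xs yt]].
by exists (x, y).
Qed.

(** Since 2 x + y is 0, 3 or 6 modulo 9, the divisions by 3 are exact. In the last two cases the
    image (X, Y) has 2 X + Y = 3 y or -3 y, hence stays in the same branch, where the map is its own
    inverse. *)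
Lemma flip3P x y : (x %% 6)%Z = 1 -> (y %% 6)%Z = 1 ->
  let: (x', y') := flip3 (x, y) in
  [/\ (x' %% 6)%Z = 1, (y' %% 6)%Z = 1, x' ^+ 2 + 2 * y' ^+ 2 = x ^+ 2 + 2 * y ^+ 2
    & flip3 (x', y') = (x, y)].
Proof.
move=> hx hy; rewrite {1}/flip3; case: eqP => e0; first by split => //; rewrite /flip3 e0.
case: eqP => e3.
  set X := (_ %/ 3)%Z; set Y := (_ %/ 3)%Z.
  have hX : 3 * X = 4 * y - x by lia.
  have hY : 3 * Y = 2 * x + y by lia.
  clearbody X Y; split; [lia | lia | | ].
  apply: (@mulfI _ 9) => //; transitivity ((3 * X) ^+ 2 + 2 * (3 * Y) ^+ 2); first by ring.
  by rewrite hX hY; ring.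
  rewrite /flip3; have -> : ((2 * X + Y) %% 9 = 3)%Z by lia.
  by congr pair; lia.
set X := (_ %/ 3)%Z; set Y := (_ %/ 3)%Z.
have hX : 3 * X = x - 4 * y by lia.
have hY : 3 * Y = - (2 * x + y) by lia.
clearbody X Y; split; [lia | lia | | ].
  apply: (@mulfI _ 9) => //; transitivity ((3 * X) ^+ 2 + 2 * (3 * Y) ^+ 2); first by ring.
  by rewrite hX hY; ring.
rewrite /flip3; have -> : ((2 * X + Y) %% 9 = 6)%Z by lia.
by congr pair; lia.
Qed.

(** The right side counts the fixed points of [flip3]: those with x = y, and those with 9 dividing 2
    x + y. The bound on [K] makes the ranges contain every solution. *)
Lemma odd_size_sols K (n : nat) : (24 * n + 3 <= K)%N ->
  odd (size (sols (urange K) (urange K) 1 2 (24 * n%:Z + 3))) =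
  odd (size [seq u <- urange K | 3 * u ^+ 2 == 24 * n%:Z + 3] +
       size (sols (urange K) (vrange K) 3 24 (24 * n%:Z + 3))).
Proof.
move=> nK; set N := 24 * n%:Z + 3.
have bnd a b x y : 1 <= a -> 1 <= b -> a * x ^+ 2 + b * y ^+ 2 = N -> (`|x| <= K)%N /\ (`|y| <= K)%N.
  by move=> *; split; nia.
have memUU x y : (x, y) \in sols (urange K) (urange K) 1 2 N <->
    [/\ (x %% 6)%Z = 1, (y %% 6)%Z = 1 & x ^+ 2 + 2 * y ^+ 2 = N].
  rewrite mem_sols mul1r; split=> [/and3P[/urange_mod ? /urange_mod ? /eqP ?] //|[x6 y6 e]].
  have [//|//||xK yK] := bnd 1 2 x y; first by rewrite mul1r.
  by rewrite !mem_urange // e eqxx.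
have memUV r v : (r, v) \in sols (urange K) (vrange K) 3 24 N <->
    [/\ (r %% 6)%Z = 1, (v %% 3)%Z = 1 & 3 * r ^+ 2 + 24 * v ^+ 2 = N].
  rewrite mem_sols; split=> [/and3P[/urange_mod ? /vrange_mod ? /eqP ?] //|[x6 y6 e]].
  have [//|//|//|xK yK] := bnd 3 24 r v.
  by rewrite mem_urange // mem_vrange // e eqxx.
have memU u : u \in [seq u <- urange K | 3 * u ^+ 2 == N] <-> (u %% 6)%Z = 1 /\ 3 * u ^+ 2 = N.
  rewrite mem_filter; split=> [/andP[/eqP ? /urange_mod ?] //|[u6 e]].
  by rewrite e eqxx mem_urange //; have [//|//||] := bnd 1 2 u u; lia.
have flipP z : z \in sols (urange K) (urange K) 1 2 N ->
    flip3 z \in sols (urange K) (urange K) 1 2 N /\ flip3 (flip3 z) = z.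
  case: z => x y /memUU[x6 y6 e]; have := flip3P x6 y6.
  case: (flip3 _) => x' y' [x6' y6' e' ->]; split=> //.
  by apply/memUU; split=> //; rewrite e'.
rewrite (@odd_size_involution _ flip3); last first.
- by move=> z /flipP[].
- by move=> z /flipP[].
- by apply: sols_uniq; apply: urange_uniq.
rewrite -size_filter -(size_map (fun u => (u, u)) [seq u <- urange K | _]).
(* This is x + y sqrt(-2) = (1 + sqrt(-2)) (-r + 2 v sqrt(-2)), of norm 3 (r^2 + 8 v^2); the
   condition 9 | 2 x + y becomes v = 1 modulo 3. *)
rewrite -(size_map (fun z => (- (z.1 + 4 * z.2), 2 * z.2 - z.1)) (sols _ (vrange K) _ _ _)).
rewrite -size_cat; congr odd; apply: perm_size; apply: uniq_perm.
- by rewrite filter_uniq // sols_uniq // urange_uniq.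
- rewrite cat_uniq; apply/and3P; split.
  + by rewrite map_inj_uniq ?filter_uniq ?urange_uniq // => u v [].
  + apply/hasPn => _ /mapP[[r v] /memUV[r6 v3 _] ->] /=.
    by apply/negP => /mapP[u _ [? ?]]; lia.
  + rewrite map_inj_uniq ?sols_uniq ?urange_uniq ?vrange_uniq // => -[r v] [r' v'] /= [? ?].
    by congr pair; lia.
case=> x y; rewrite mem_filter mem_cat; apply/andP/orP => [[fz /memUU[x6 y6 e]]|].
  have [e9|ne9] := eqVneq ((2 * x + y) %% 9)%Z 0.
    right; apply/mapP; exists ((- (x + 2 * y)) %/ 3, (y - x) %/ 6)%Z => /=; last by congr pair; lia.
    set r := (_ %/ 3)%Z; set v := (_ %/ 6)%Z.
    have ex : x = - (r + 4 * v) by lia.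
    have ey : y = 2 * v - r by lia.
    by apply/memUV; split; [lia|lia|rewrite -e ex ey; ring].
  left; apply/mapP; exists x; last first.
    move: fz; rewrite /= (negPf ne9); case: ifP => _ /eqP[? ?]; congr pair; lia.
  apply/memU; split=> //; move: fz; rewrite /= (negPf ne9); case: ifP => _ /eqP[? ?].
    have exy : y = x by lia.
    by rewrite -e exy; ring.
  by exfalso; lia.
case=> /mapP.
  case=> u /memU[u6 e] [-> ->]; split.
    rewrite /=; have -> : ((2 * u + u) %% 9)%Z = 3 by lia.
    by apply/eqP; congr pair; lia.
  by apply/memUU; split=> //; rewrite -e; ring.
case=> [[r v]] /memUV[r6 v3 e] /= [-> ->]; split.
  by rewrite /=; have -> : ((2 * (- (r + 4 * v)) + (2 * v - r)) %% 9)%Z = 0 by lia.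
by apply/memUU; split; [lia|lia|rewrite -e; ring].
Qed.

(** Multiplying exponents by 24 and adding 3 turns the coefficients of degree [n] into the three
    counts of [odd_size_sols]. *)
Lemma pent_theta L K : (24 * L <= K)%N ->
  eqX L (Epoly K * (Epoly K \Po 'X^2)) ((Epoly K \Po 'X^3) * (1 + Wpoly K)).
Proof.
move=> LK n nL; rewrite mulrDr mulr1 coefD !comp_sumX !mul_sumX !coef_sumX -natrD.
rewrite natr_F2_odd [RHS]natr_F2_odd; congr (_%:R); congr nat_of_bool.
have nK : (24 * n + 3 <= K)%N by lia.
have := odd_size_sols nK; rewrite /sols !size_filter.
congr (odd _ = odd (_ + _)); apply: eq_in_count.
- case=> x y; case/allpairsP => [[x' y'] /= [/urange_mod/pentP ex /urange_mod/pentP ey [-> ->]]].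
  rewrite ex ey; lia.
- move=> u /urange_mod/pentP ->; lia.
- case=> u v; case/allpairsP => [[x' y'] /= [/urange_mod/pentP ex _ [-> ->]]].
  rewrite ex; lia.
Qed.

(** * Generating function of b3(2m) modulo 2 *)

(** Even squares come from v = -2 w, where the sign keeps the residue 1 modulo 3. For odd [i], the
    exponent 2 i is 2 modulo 4 and is not a square. *)
Lemma even_Wpoly L K : (2 * L <= K)%N -> eqX L (even_poly (Wpoly K)) (Wpoly K \Po 'X^2).
Proof.
move=> LK i iL; rewrite coef_even_poly coef_compXn // !coef_sumX dvdn2.
case: ifPn => [/negPf iodd|/negPn iodd].
  congr (_%:R); rewrite -!size_filter -(size_map (fun w => - (2 * w)) [seq v <- _ | _ == (i %/ 2)%N]).
  apply/perm_size/uniq_perm; rewrite ?map_inj_uniq ?filter_uniq ?vrange_uniq //; first by move=> x y; lia.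
  have ei : i = (2 * (i %/ 2))%N by lia.
  move=> v; rewrite mem_filter; apply/andP/mapP => [[/eqP vi /vrange_mod v3]|[w]].
    have v2 : (v %% 2)%Z = 0.
      by apply/eqP; have [//|] := eqVneq (v %% 2)%Z 0; nia.
    exists (- (v %/ 2)%Z); last by lia.
    have ev : v = 2 * (v %/ 2)%Z by lia.
    move: (v %/ 2)%Z ev => k ev; rewrite mem_filter; apply/andP.
    have ek : (2 * `|k| ^ 2 = i)%N by move: vi; rewrite ev abszM expnMn; lia.
    split; first by rewrite abszN {}ei in ek *; apply/eqP; lia.
    apply: mem_vrange; first by lia.
    by clear -ek iL LK; nia.
  rewrite mem_filter => /andP[/eqP wi /vrange_mod w3] ->; split; first by rewrite abszN abszM expnMn wi /=; lia.
  apply: mem_vrange; first by lia.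
  by clear -wi iL LK; nia.
rewrite (@eq_in_count _ _ pred0) ?count_pred0 // => v _ /=; apply/eqP => vi.
have [e|e] : (v = 2 * (v %/ 2)%Z) \/ (v = 2 * (v %/ 2)%Z + 1) by lia.
  nia.
nia.
Qed.

Lemma euler_prod0 K : (euler_prod K)`_0 = 1.
Proof.
suff : eqX 1 (euler_prod K) 1 by move=> ->; rewrite ?coef1.
rewrite /euler_prod big_nat_cond; apply: eqX_prod1 => k /andP[/andP[k0 _] _].
exact: eqX_addX.
Qed.

Lemma Wpoly0 K : (Wpoly K)`_0 = 0.
Proof.
rewrite coef_sumX (@eq_in_count _ _ pred0) ?count_pred0 // => v /vrange_mod v3 /=.
by apply/eqP; nia.
Qed.

Lemma euler_pent K : eqX K.+1 (euler_prod K) (Epoly K).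
Proof. by rewrite -shanks_pent; apply: eqX_sym; apply: shanks_euler. Qed.

(* From [G F = F(q^3)] and [F F(q^2) = F(q^3) S] one gets [G S = F(q^2)], and so
   [G S(q^2) = F(q^2) S] on multiplying by [S].  The even powers of [q] in [S]
   make up [S(q^4) = S(q^2) ^ 2], whence those in [G] make up [F(q^2) S(q^2)]. *)
Lemma b3_double K m : (48 * m.+1 <= K)%N ->
  (b3 (2 * m))%:R = (Epoly K * (1 + Wpoly K))`_m :> 'F_2.
Proof.
move=> mK; set L := m.+1; rewrite -polyC1; set S := _ + Wpoly K; set F := euler_prod K.
set G := reg3_prod K.
(* Precision [L.*2] is carried until taking even parts halves it to [L]. *)
have FE k : (0 < k)%N -> eqX L.*2 (F \Po 'X^k) (Epoly K \Po 'X^k).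
  by move=> k0; apply: (@eqX_le _ (k * K.+1)); [nia | apply: eqX_comp => //; apply: euler_pent].
have FE1 : eqX L.*2 F (Epoly K) by apply: eqX_le (@euler_pent K); lia.
have theta : eqX L.*2 (F * (F \Po 'X^2)) ((F \Po 'X^3) * S).
  apply: (eqX_trans (eqXM FE1 (FE 2%N isT))).
  apply: (@eqX_trans _ _ ((Epoly K \Po 'X^3) * S)); first by apply: pent_theta; lia.
  by apply: eqXM => //; apply: eqX_sym; apply: FE.
have GF : eqX L.*2 (G * F) (F \Po 'X^3) by apply: eqX_le (@reg3_mul_euler K); lia.
have GS : eqX L.*2 (G * S) (F \Po 'X^2).
  apply: (@eqX_cancel _ _ F); first exact: euler_prod0.
  rewrite mulrA (mulrC F); apply: eqX_trans (eqX_sym theta).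
  exact: eqXM.
have GSS : eqX L.*2 ((S \Po 'X^2) * G) ((F \Po 'X^2) * S).
  by rewrite -sqr_poly_F2 expr2 mulrC mulrA; apply: eqXM.
have Seven : eqX L (even_poly S) (S * S).
  rewrite -expr2 sqr_poly_F2 /S even_polyD rmorphD /= comp_polyC even_polyC.
  by apply: eqXD => //; apply: even_Wpoly; lia.
have Geven : eqX L (even_poly G) (F * S).
  apply: (@eqX_cancel _ _ S); first by rewrite coefD coefC Wpoly0 addr0.
  have := eqX_even GSS; rewrite !even_poly_comp => /eqX_trans; apply.
  by rewrite mulrCA; apply: eqXM.
rewrite -coef_reg3_prod -(@reg3_prod_trunc _ K) //; last by lia.
rewrite mul2n -coef_even_poly Geven //.
by apply: (eqXM (L := L)) => //; apply: eqX_le FE1; lia.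
Qed.

(** * Primes represented by quadratic forms *)

Lemma Euclid_dvdzM (p : nat) (x y : int) : prime p ->
  (p%:Z %| x * y)%Z = (p%:Z %| x)%Z || (p%:Z %| y)%Z.
Proof. by move=> pr; rewrite !dvdzE abszM Euclid_dvdM. Qed.

Lemma Euclid_dvdz_sqr (p : nat) (x : int) : prime p ->
  (p%:Z %| x ^+ 2)%Z = (p%:Z %| x)%Z.
Proof. by move=> pr; rewrite expr2 Euclid_dvdzM // orbb. Qed.

(** If p divided x it would divide b y^2, hence y, and then p^2 would divide p. *)
Lemma prime_form_ndvdz (p : nat) (a b x y : int) : prime p -> ~~ (p%:Z %| b)%Z ->
  a * x ^+ 2 + b * y ^+ 2 = p%:Z -> ~~ (p%:Z %| x)%Z.
Proof.
move=> pr pb e; apply/negP => /dvdzP[x' ex].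
have : (p%:Z %| b * y ^+ 2)%Z.
  apply/dvdzP; exists (1 - a * x' ^+ 2 * p%:Z).
  transitivity (p%:Z - a * x ^+ 2); first by rewrite -e; ring.
  by rewrite ex; ring.
rewrite Euclid_dvdzM // (negPf pb) Euclid_dvdz_sqr //= => /dvdzP[y' ey].
have p1 := prime_gt1 pr.
have e1 : (a * x' ^+ 2 + b * y' ^+ 2) * p%:Z = 1.
  by apply: (@mulfI _ p%:Z); [lia | rewrite mulr1 -[RHS]e ex ey; ring].
by have /eqP := congr1 absz e1; rewrite abszM muln_eq1 /= => /andP[_ /eqP ep]; rewrite ep in p1.
Qed.

Lemma sqr_mod6 (x : int) : (x ^+ 2 %% 6 = 1)%Z -> (x %% 6)%Z = 1 \/ (x %% 6)%Z = 5.
Proof.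
move=> h; have ex : x = 6 * (x %/ 6)%Z + (x %% 6)%Z by lia.
move: h; rewrite {1}ex; set q := (x %/ 6)%Z.
have -> : (6 * q + (x %% 6)%Z) ^+ 2 = 6 * (6 * q ^+ 2 + 2 * q * (x %% 6)%Z) + (x %% 6)%Z ^+ 2 by ring.
have [e|[e|[e|[e|[e|e]]]]] : (x %% 6)%Z = 0 \/ (x %% 6)%Z = 1 \/ (x %% 6)%Z = 2 \/ (x %% 6)%Z = 3
  \/ (x %% 6)%Z = 4 \/ (x %% 6)%Z = 5 by lia.
all: rewrite e; lia.
Qed.

Lemma ndvdz_smooth6 (p b : nat) : prime p -> (p%:Z ^+ 2 %% 6 = 1)%Z ->
  (b %| 6 ^ 3)%N -> ~~ (p%:Z %| b%:Z)%Z.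
Proof.
move=> pr p6 b6; rewrite dvdzE /=; apply/negP => /dvdn_trans /(_ b6).
rewrite Euclid_dvdX // => /andP[pd6 _]; have ple : (p <= 6)%N by apply: dvdn_leq.
by move: p6 pr pd6 ple; move: (p) => [|[|[|[|[|[|[|q]]]]]]].
Qed.

(* If [pi] is [x + y sqrt(-54)] or [x sqrt 2 + y sqrt(-27)], of norm [p], then
   [c + f sqrt(-216)] is [pi ^ 2]. *)
Lemma calP_sqr (p : nat) : calP p -> (p%:Z ^+ 2 %% 6 = 1)%Z ->
  exists c f : int, [/\ c ^+ 2 + 216 * f ^+ 2 = p%:Z ^+ 2, ~~ (p%:Z %| f)%Z
    & (c %% 6 = p%:Z %% 6)%Z].
Proof.
move=> [pr [j jin [X [Y [_ e]]]]] p6.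
have pN b : (b %| 6 ^ 3)%N -> ~~ (p%:Z %| b%:Z)%Z by apply: ndvdz_smooth6.
suff [c [f [ecf pf]]] : exists c f : int, c ^+ 2 + 216 * f ^+ 2 = p%:Z ^+ 2 /\ ~~ (p%:Z %| f)%Z.
  (* Both c and p are 1 or -1 modulo 6, so changing the sign of c if necessary gives the
     congruence. *)
  have c6 : (c ^+ 2 %% 6 = 1)%Z by lia.
  have := sqr_mod6 p6; have := sqr_mod6 c6 => h1 h2.
  have [h|h] : (c %% 6 = p%:Z %% 6)%Z \/ (- c %% 6 = p%:Z %% 6)%Z by clear -h1 h2; lia.
    by exists c, f.
  by exists (- c), f; rewrite sqrrN.
have prodN a b (x y : int) : (a %| 6 ^ 3)%N -> (b %| 6 ^ 3)%N ->
    a%:Z * x ^+ 2 + b%:Z * y ^+ 2 = p%:Z -> ~~ (p%:Z %| x * y)%Z.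
  move=> a6 b6 exy; rewrite Euclid_dvdzM // negb_or.
  rewrite (prime_form_ndvdz pr (pN _ b6) exy) /=.
  by move: exy; rewrite addrC => /(prime_form_ndvdz pr (pN _ a6)).
have half (x z : int) : x ^+ 2 = 2 * z -> exists y, x = 2 * y.
  move=> exz; have [h|h] : (x = 2 * (x %/ 2)%Z) \/ (x = 2 * (x %/ 2)%Z + 1) by lia.
    by exists (x %/ 2)%Z.
  exfalso; move: exz; rewrite h; move: (x %/ 2)%Z => k; lia.
(* Parity of X reduces the three cases to p = X^2 + 216 Y^2, p = (X / 2)^2 + 54 Y^2 and p = 2 (X /
   4)^2 + 27 Y^2. *)
move: jin; rewrite !inE => /or3P[] /eqP ej; rewrite {}ej in e.
- have e' : 1%:Z * X ^+ 2 + 216%:Z * Y ^+ 2 = p%:Z by lia.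
  exists (X ^+ 2 - 216 * Y ^+ 2), (2%:Z * (X * Y)); split; first by rewrite -e'; ring.
  by rewrite Euclid_dvdzM // negb_or pN // (prodN 1%N 216%N).
- have [X' eX] : exists y, X = 2 * y by apply: (half _ (2 * p%:Z - 108 * Y ^+ 2)); lia.
  have e' : 1%:Z * X' ^+ 2 + 54%:Z * Y ^+ 2 = p%:Z by move: e; rewrite eX; lia.
  exists (X' ^+ 2 - 54 * Y ^+ 2), (X' * Y); split; first by rewrite -e'; ring.
  by rewrite (prodN 1%N 54%N).
- have [X' eX] : exists y, X = 2 * y by apply: (half _ (4 * p%:Z - 108 * Y ^+ 2)); lia.
  have [X2 eX'] : exists y, X' = 2 * y by apply: (half _ (p%:Z - 27 * Y ^+ 2)); move: e; rewrite eX; lia.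
  have e' : 2%:Z * X2 ^+ 2 + 27%:Z * Y ^+ 2 = p%:Z by move: e; rewrite eX eX'; lia.
  exists (2 * X2 ^+ 2 - 27 * Y ^+ 2), (X2 * Y); split; first by rewrite -e'; ring.
  by rewrite (prodN 2%N 27%N).
Qed.

(** * Pairing the solutions of u^2 + 24 v^2 = N *)

Definition rotate (p c f : int) (z : int * int) : int * int :=
  (((z.1 * c + 72 * z.2 * f) %/ p)%Z, ((z.2 * c - 3 * z.1 * f) %/ p)%Z).

(* [rotate] multiplies [u + v sqrt(-24)] by the conjugate of
   [(c + 3 f sqrt(-24)) / p], an element of norm 1. *)
Lemma rotateP (p : nat) (c f u v N : int) : prime p -> (p%:Z ^+ 2 %% 6 = 1)%Z ->
  c ^+ 2 + 216 * f ^+ 2 = p%:Z ^+ 2 -> ~~ (p%:Z %| f)%Z -> (c %% 6 = p%:Z %% 6)%Z ->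
  u ^+ 2 + 24 * v ^+ 2 = N -> (p%:Z %| N)%Z -> ~~ (p%:Z ^+ 2 %| N)%Z ->
  (p%:Z %| v * c - 3 * u * f)%Z ->
  forall u' v', rotate p%:Z c f (u, v) = (u', v') ->
  [/\ u' ^+ 2 + 24 * v' ^+ 2 = N, (u' %% 6 = u %% 6)%Z, (v' %% 3 = v %% 3)%Z
   & [/\ ~~ (p%:Z %| v' * c - 3 * u' * f)%Z, (p%:Z %| v' * c + 3 * u' * f)%Z,
      rotate p%:Z c (- f) (u', v') = (u, v) & (u', v') <> (u, v)]].
Proof.
move=> pr p6 ec pf cp eN pN p2N /dvdzP[V eV].
have p0 : p%:Z != 0 by have := prime_gt0 pr; lia.
have mulpI : injective ( *%R p%:Z) := mulfI p0.
(* The product has norm p^2 N, so divisibility of one coordinate by p forces that of the other. *)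
have /dvdzP[U eU] : (p%:Z %| u * c + 72 * v * f)%Z.
  rewrite -Euclid_dvdz_sqr //; apply/dvdzP; exists (p%:Z * (N - 24 * V ^+ 2)).
  have -> : (u * c + 72 * v * f) ^+ 2 =
    (c ^+ 2 + 216 * f ^+ 2) * (u ^+ 2 + 24 * v ^+ 2) - 24 * (v * c - 3 * u * f) ^+ 2 by ring.
  by rewrite ec eN eV; ring.
move=> u' v'; rewrite /rotate /= eU eV !mulzK // => -[<- <-] {u' v'}.
have eV2 : V * c + 3 * U * f = p%:Z * v.
  apply: (mulpI); have -> : p%:Z * (V * c + 3 * U * f) = (V * p%:Z) * c + 3 * (U * p%:Z) * f by ring.
  rewrite -eU -eV; transitivity (v * (c ^+ 2 + 216 * f ^+ 2)); first by ring.
  by rewrite ec; ring.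
have eU2 : U * c - 72 * V * f = p%:Z * u.
  apply: (mulpI); have -> : p%:Z * (U * c - 72 * V * f) = (U * p%:Z) * c - 72 * (V * p%:Z) * f by ring.
  rewrite -eU -eV; transitivity (u * (c ^+ 2 + 216 * f ^+ 2)); first by ring.
  by rewrite ec; ring.
have eN' : U ^+ 2 + 24 * V ^+ 2 = N.
  apply: (mulpI); apply: (mulpI).
  transitivity ((U * p%:Z) ^+ 2 + 24 * (V * p%:Z) ^+ 2); first by ring.
  rewrite -eU -eV; transitivity ((c ^+ 2 + 216 * f ^+ 2) * (u ^+ 2 + 24 * v ^+ 2)); first by ring.
  by rewrite ec eN; ring.
have p6' := sqr_mod6 p6.
have [k ck] : exists k, c = p%:Z + 6 * k by exists ((c - p%:Z) %/ 6)%Z; clear -cp; lia.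
have ndvd b : (b %| 6 ^ 3)%N -> ~~ (p%:Z %| b%:Z)%Z by apply: ndvdz_smooth6.
have pc : ~~ (p%:Z %| c)%Z.
  apply/negP => /dvdzP[c' ec']; have : (p%:Z %| 216%:Z * f ^+ 2)%Z.
    apply/dvdzP; exists ((1 - c' ^+ 2) * p%:Z).
    transitivity (p%:Z ^+ 2 - c ^+ 2); first by rewrite -ec; ring.
    by rewrite ec'; ring.
  by rewrite Euclid_dvdzM // Euclid_dvdz_sqr // (negPf pf) orbF (negPf (ndvd 216%N isT)).
split=> //.
- have e : (U - u) * p%:Z = 6 * (u * k + 12 * v * f) by rewrite mulrBl -eU ck; ring.
  by move: e; clear -p6'; rewrite {1}(_ : p%:Z = 6 * (p%:Z %/ 6)%Z + (p%:Z %% 6)%Z); [case: p6' => ->; lia | lia].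
- have e : (V - v) * p%:Z = 3 * (2 * v * k - u * f) by rewrite mulrBl -eV ck; ring.
  by move: e; clear -p6'; rewrite {1}(_ : p%:Z = 6 * (p%:Z %/ 6)%Z + (p%:Z %% 6)%Z); [case: p6' => ->; lia | lia].
split.
(* Together with [eV2], division in the same direction again would give p | 2 V c, so p would divide
   V, then U, and p^2 would divide N. *)
- apply/negP => pd.
  have : (p%:Z %| 2%:Z * (V * c))%Z.
    have -> : 2%:Z * (V * c) = p%:Z * v + (V * c - 3 * U * f) by rewrite -eV2; ring.
    by rewrite rpredD // dvdz_mulr.
  rewrite !Euclid_dvdzM // (negPf pc) (negPf (ndvd 2%N isT)) orbF /= => pV.
  case/dvdzP: pV => v' ev'; case/dvdzP: pN => N' eNp.
  have /dvdzP[u' eu'] : (p%:Z %| U)%Z.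
    rewrite -Euclid_dvdz_sqr //; apply/dvdzP; exists (N' - 24 * v' ^+ 2 * p%:Z).
    by rewrite mulrBl -eNp -eN' ev'; ring.
  case/negP: p2N; apply/dvdzP; exists (u' ^+ 2 + 24 * v' ^+ 2).
  by rewrite -eN' ev' eu'; ring.
- by rewrite eV2 dvdz_mulr.
- congr pair.
    by rewrite mulrN eU2 mulrC mulzK.
  by rewrite mulrN opprK eV2 mulrC mulzK.
(* Eliminating p from the two equations of a fixed point leaves 3 f N = 0. *)
- case=> eUu eVv; rewrite eUu eVv in eU eV.
  have : 3 * f * N = 0.
    rewrite -eN; transitivity (v * (u * c + 72 * v * f) - u * (v * c - 3 * u * f)); first by ring.
    by rewrite eU eV; ring.
  move/eqP; rewrite !mulf_eq0 /= => /orP[/eqP f0|/eqP N0].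
    by rewrite f0 dvdz0 in pf.
  by rewrite N0 dvdz0 in p2N.
Qed.

(** As (v c - 3 u f) (v c + 3 u f) = p^2 v^2 - 9 f^2 N, p divides one factor, and [rotateP] shows
    that the image calls for the opposite rotation. Hence [tau] is an involution without fixed
    points. *)
Lemma even_size_sols (p : nat) (c f N : int) K : prime p -> (p%:Z ^+ 2 %% 6 = 1)%Z ->
  c ^+ 2 + 216 * f ^+ 2 = p%:Z ^+ 2 -> ~~ (p%:Z %| f)%Z -> (c %% 6 = p%:Z %% 6)%Z ->
  (p%:Z %| N)%Z -> ~~ (p%:Z ^+ 2 %| N)%Z -> N <= K%:Z ->
  ~~ odd (size (sols (urange K) (vrange K) 1 24 N)).
Proof.
move=> pr p6 ec pf cp pN p2N NK.
have memUV u v : (u, v) \in sols (urange K) (vrange K) 1 24 N <->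
    [/\ (u %% 6)%Z = 1, (v %% 3)%Z = 1 & u ^+ 2 + 24 * v ^+ 2 = N].
  rewrite mem_sols mul1r; split=> [/and3P[/urange_mod ? /vrange_mod ? /eqP ?] //|[u6 v3 e]].
  rewrite mem_urange ?mem_vrange ?e ?eqxx // -lez_nat; clear -e NK; nia.
have ecN : c ^+ 2 + 216 * (- f) ^+ 2 = p%:Z ^+ 2 by rewrite sqrrN.
have pfN : ~~ (p%:Z %| - f)%Z by rewrite dvdzE abszN.
pose tau z := if (p%:Z %| z.2 * c - 3 * z.1 * f)%Z then rotate p%:Z c f z else rotate p%:Z c (- f) z.
have tauP z : z \in sols (urange K) (vrange K) 1 24 N ->
    [/\ tau z \in sols (urange K) (vrange K) 1 24 N, tau (tau z) = z & tau z <> z].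
  case: z => u v /memUV[u6 v3 e]; rewrite /tau /=; case: ifPn => pd.
    case E: (rotate _ _ _ _) => [u' v'] /=.
    have [e' u6' v3' [pd' _ rK ne]] := rotateP pr p6 ec pf cp e pN p2N pd E; rewrite (negPf pd').
    by split=> //; apply/memUV; split=> //; rewrite ?u6' ?v3'.
  have pd2 : (p%:Z %| v * c - 3 * u * (- f))%Z.
    rewrite mulrN opprK; have : (p%:Z %| (v * c - 3 * u * f) * (v * c + 3 * u * f))%Z.
      case/dvdzP: pN => N' eN'; apply/dvdzP; exists (p%:Z * v ^+ 2 - 9 * f ^+ 2 * N').
      transitivity (v ^+ 2 * p%:Z ^+ 2 - 9 * f ^+ 2 * N); last by rewrite eN'; ring.
      by rewrite -ec -e; ring.
    by rewrite Euclid_dvdzM // (negPf pd).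
  case E: (rotate _ _ _ _) => [u' v'] /=.
  have [e' u6' v3' [_ pd' rK ne]] := rotateP pr p6 ecN pfN cp e pN p2N pd2 E.
  rewrite mulrN in pd'; rewrite opprK in rK; rewrite pd'.
  by split=> //; apply/memUV; split=> //; rewrite ?u6' ?v3'.
rewrite (@odd_size_involution _ tau).
- rewrite (@eq_in_count _ _ pred0) ?count_pred0 // => z /tauP[_ _ ne] /=.
  exact/eqP.
- by rewrite sols_uniq ?urange_uniq ?vrange_uniq.
- by move=> z /tauP[].
- by move=> z /tauP[].
Qed.

(** * Conclusion: the residue of alpha *)

(** A divisor of 24 x + 1 is prime to 6, and squares of such integers are 1 modulo 24. *)
Lemma sqr_dvd24 (d x : int) : (d %| 24 * x + 1)%Z -> exists k, d ^+ 2 = 24 * k + 1.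
Proof.
case/dvdzP => q; have ed : d = 6 * (d %/ 6)%Z + (d %% 6)%Z by lia.
have [d1|[d5|nd]] : (d %% 6)%Z = 1 \/ (d %% 6)%Z = 5 \/
  ((d %% 6)%Z = 0 \/ (d %% 6)%Z = 2 \/ (d %% 6)%Z = 3 \/ (d %% 6)%Z = 4) by lia.
- by move=> _; exists (pent d)%:Z; apply: pentP.
- move=> _; exists (pent (- d))%:Z; rewrite -sqrrN; apply: pentP.
  by clear -d5; lia.
rewrite ed; case: nd => [e|[e|[e|e]]]; rewrite e => eq; exfalso; clear -eq; lia.
Qed.

Lemma b3_double_even (p m : nat) : calP p -> (p%:Z %| (24 * m + 1)%N%:Z)%Z ->
  ~~ (p%:Z ^+ 2 %| (24 * m + 1)%N%:Z)%Z -> ~~ odd (b3 (2 * m)).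
Proof.
move=> pP pN p2N; have pr : prime p by case: pP.
have p6 : (p%:Z ^+ 2 %% 6 = 1)%Z.
  have [k ->] : exists k, p%:Z ^+ 2 = 24 * k + 1 by apply: (@sqr_dvd24 _ m); rewrite -PoszM -PoszD.
  by clear; lia.
have [c [f [ec pf cp]]] := calP_sqr pP p6.
set K := (48 * m.+1)%N.
have NK : (24 * m + 1)%N%:Z <= K%:Z by lia.
have /negPf evenS := even_size_sols pr p6 ec pf cp pN p2N NK.
have : (b3 (2 * m))%:R = 0 :> 'F_2.
  rewrite (@b3_double K) // mulrDr mulr1 coefD mul_sumX !coef_sumX.
  (* The solutions with v = 0 would make 24 m + 1 a square, impossible when p divides it exactly
     once. *)
  rewrite (@eq_in_count _ _ pred0) ?count_pred0 ?add0r; last first.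
    move=> u /urange_mod/pentP eu /=; apply/eqP => um; case/negP: p2N.
    have -> : (24 * m + 1)%N%:Z = u ^+ 2 by lia.
    by rewrite dvdz_exp2r // -Euclid_dvdz_sqr // eu um; rewrite PoszD PoszM in pN.
  rewrite natr_F2_odd -[RHS](_ : false%:R = 0) //; congr (_%:R); congr nat_of_bool.
  rewrite -evenS /sols size_filter; congr odd; apply: eq_in_count.
  case=> u v; case/allpairsP => [[u' v'] /= [/urange_mod/pentP ex _ [-> ->]]].
  by rewrite ex; clear; lia.
by rewrite natr_F2_odd; case: odd.
Qed.

(* The argument of b3 is a positive integer, as - inv24 >= 1, so absz only
   serves as the cast from int to nat. *)
Theorem theorem1p3 (p n : nat) (inv24 : int) (alpha : nat) :
  calP p ->
  (24 * inv24 = 1 %[mod p%:Z])%Z ->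
  1 <= - inv24 <= p%:Z - 1 ->
  (alpha < p)%N ->
  alpha <> (p %/ 24)%N ->
  b3 (absz (2 * (p%:Z ^+ 2 * n%:Z + p%:Z * alpha%:Z - inv24))%R)
    = 0%N %[mod 2].
Proof.
move=> pP inv /andP[inv1 invp] ap aNp; set X := _ - inv24.
have X0 : 0 <= X by rewrite /X; nia.
rewrite abszM modn2 mod0n; set m := `|X|%N.
have mX : m%:Z = X by rewrite /m gez0_abs.
have pr : prime p by case: pP.
have /dvdzP[t et] : (p%:Z %| 1 - 24 * inv24)%Z.
  by rewrite -eqz_mod_dvd; apply/eqP.
have eN : (24 * m + 1)%N%:Z = p%:Z * (24 * p%:Z * n%:Z + 24 * alpha%:Z + t).
  rewrite PoszD PoszM mX /X; transitivity (24 * (p%:Z ^+ 2 * n%:Z + p%:Z * alpha%:Z) + (1 - 24 * inv24)); first by ring.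
  by rewrite et; ring.
apply/eqP; rewrite eqb0; apply: (b3_double_even pP); first by rewrite eN dvdz_mulr.
have p0 : p%:Z != 0 by have := prime_gt0 pr; lia.
(* If p^2 divides 24 m + 1, then 24 alpha + t = p s. The bounds on [inv24] and [alpha] give 0 < t <
   24 and 0 < s < 24; modulo 24, s = p^2 s = p t = 1. So s = 1 and p = 24 alpha + t, making alpha
   the excluded quotient. *)
rewrite eN expr2 dvdz_mul2l //; apply/negP => /dvdzP[s' es'].
have {s' es'} [s es] : exists s, 24 * alpha%:Z + t = p%:Z * s.
  exists (s' - 24 * n%:Z); rewrite mulrBr (mulrC _ s') -es'; ring.
have [k ep2] : exists k, p%:Z ^+ 2 = 24 * k + 1.
  by apply: (@sqr_dvd24 _ (- inv24)); apply/dvdzP; exists t; rewrite -et; ring.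
have p_gt0 : 0 < p%:Z by have := prime_gt0 pr; lia.
have [t0 t24] : 0 < t /\ t < 24 by clear -et p_gt0 inv1 invp; split; nia.
have [s0 s24] : 0 < s /\ s < 24 by clear -es p_gt0 t0 t24 ap; split; nia.
have es24 : s = 1 + 24 * (alpha%:Z * p%:Z - inv24 - s * k).
  transitivity (s * p%:Z ^+ 2 - 24 * s * k); first by rewrite ep2; ring.
  transitivity (p%:Z * (p%:Z * s) - 24 * s * k); first by ring.
  transitivity (24 * (alpha%:Z * p%:Z - s * k) + t * p%:Z); first by rewrite -es; ring.
  by rewrite -et; ring.
have s1 : s = 1 by move: es24; set z := (_ - s * k); clearbody z; clear -s0 s24; lia.
by apply: aNp; clear -es s1 t0 t24; rewrite s1 in es; lia.
Qed.
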